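(* Let $k\geq 1$ and let $\mathcal{G}=\{G_1,\ldots,G_m\}$ be a family of $m$ $k$-element subsets of $\{1,\ldots,n\}$ such that no two pairwise intersections coincide, i.e. for all $i\neq j$ and $s\neq t$ in $\{1,\ldots,m\}$, $\{i,j\}\neq\{s,t\}$ implies $G_i\cap G_j\neq G_s\cap G_t$. For $j\in\{1,\ldots,n\}$ let $\lambda_j$ denote the proportion of those members of $\mathcal{G}$ that contain $j$, i.e. $\lambda_j=|\{i: j\in G_i\}|/m$. If $\lambda_j\leq 1/\sqrt{2}$ for all $j\in\{1,\ldots,n\}$, then for all $\alpha\in[1,3.67]$, $$\ln_\alpha\binom{m}{2}\leq k\,\frac{h_\alpha(\lambda^2)}{\lambda},\qquad\text{where}\quad \lambda:=\sum_{j=1}^n\frac{\lambda_j}{k}\,\lambda_j .$$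
   Context: For $\xi>0$, the $\alpha$-logarithm is $\ln_\alpha(\xi)=\frac{\xi^{1-\alpha}-1}{1-\alpha}$ for $\alpha>0$, $\alpha\neq1$, and $\ln_1(\xi)=\ln\xi$. For $q\in[0,1]$ the binary Tsallis--Havrda--Charv\'at entropy is $h_\alpha(q)=-q^\alpha\ln_\alpha(q)-(1-q)^\alpha\ln_\alpha(1-q)$, where a term with argument $0$ is taken to be $0$; thus for $\alpha\neq1$, $h_\alpha(q)=\frac{q^\alpha+(1-q)^\alpha-1}{1-\alpha}$, and $h_1(q)=-q\ln q-(1-q)\ln(1-q)$. *)

(* Defs.v *)
From mathcomp Require Import all_boot all_order all_algebra.
From mathcomp Require Import all_classical all_reals all_analysis.

Set Implicit Arguments.
Unset Strict Implicit.
Unset Printing Implicit Defensive.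

Import Order.TTheory GRing.Theory Num.Theory.

Local Open Scope ring_scope.

(* Meaningful only for 0 < xi and 0 < alpha. *)
Definition ln_alpha (R : realType) (alpha xi : R) : R :=
  if alpha == 1 then ln xi
  else (xi `^ (1 - alpha) - 1) / (1 - alpha).

(* The summand - q^alpha ln_alpha(q), with the convention that it vanishes at
   q = 0. *)
Definition entropy_term (R : realType) (alpha q : R) : R :=
  if q == 0 then 0 else - (q `^ alpha * ln_alpha alpha q).

(* Binary Tsallis-Havrda-Charvat entropy, meaningful only for 0 <= q <= 1. *)
Definition h_alpha (R : realType) (alpha q : R) : R :=
  entropy_term alpha q + entropy_term alpha (1 - q).

Definition distinct_intersections (n m : nat) (G : 'I_m -> {set 'I_n}) : Prop :=
  forall i j s t : 'I_m, i != j -> s != t ->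
    [set i; j]%SET != [set s; t]%SET ->
    (G i :&: G j)%SET != (G s :&: G t)%SET.

Definition containing_proportion (R : realType) (n m : nat)
    (G : 'I_m -> {set 'I_n}) (j : 'I_n) : R :=
  #|[set i : 'I_m | j \in G i]%SET|%:R / m%:R.

(* Main.v *)
Require Import Defs.
From mathcomp Require Import all_boot all_order all_algebra.
From mathcomp Require Import all_classical all_reals all_analysis.
From mathcomp Require Import ring lra.

Set Implicit Arguments.
Unset Strict Implicit.
Unset Printing Implicit Defensive.

Import Order.TTheory GRing.Theory Num.Theory.
Import numFieldNormedType.Exports.

Local Open Scope ring_scope.

(** The proof is an entropy count.  Choose one of the N = C(m,2) pairs {i, j}
    uniformly.  As distinct pairs have distinct intersections, the random set
    G_i :&: G_j is uniform on N values, so its Tsallis entropy is ln_alpha N.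
    For alpha >= 1 this entropy is subadditive over the coordinates of the
    indicator vector (entropy_subadditive), and the coordinate x equals 1 with
    probability C(d,2) / C(m,2) <= lambda_x ^ 2, where d = m lambda_x
    (bin2_ratio_le).  Since lambda_x ^ 2 <= 1/2 and h_alpha increases on
    [0, 1/2], this gives
      ln_alpha N <= sum_x h_alpha (lambda_x ^ 2)
                  = k * sum_x (lambda_x / k) * (h_alpha (lambda_x ^ 2) / lambda_x),
    where points with lambda_x = 0 contribute nothing.
    The weights lambda_x / k sum to 1, because each G_i has k elements.  So the
    claim is Jensen's inequality for y |-> h_alpha (y ^ 2) / y, and what has to
    be shown is that this function is concave on ]0, 1/sqrt 2]
    (entropy_ratio_tangent).

    For concavity, put t = y ^ 2.  Up to a positive factor the derivative is
      2 a (1 - t)^(a-1) + ((1 - t)^a - 1) / t - (2 a - 1) t^(a-1),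
    with a = alpha.  The last summand decreases.  The other two together have a
    derivative that is at most 0 exactly when
      1 <= (1 - t)^a + a t (1 - t)^(a-1) + 2 a (a-1) t^2 (1 - t)^(a-2),
    which for 0 < t <= 1/2 and 1 < a <= 4 follows from Bernoulli's inequality
    for exponents in [0, 1] (ratio_slope_ineq).

    These arguments take place for alpha > 1, where (alpha - 1) h_alpha is the
    function q |-> 1 - q^alpha - (1-q)^alpha.  The case alpha = 1 follows by
    letting alpha decrease to 1: h_alpha <= h_1 (h_alpha_le_shannon), while
    ln_alpha N is at least ln N / (1 + (alpha - 1) ln N) (ln_le_ln_alpha). *)

(** * A Bernoulli-type inequality *)

(** Bernoulli's inequality: [y `^ r] is the exponential of a convex combination of
    [ln y] and 0, and the exponential is convex. *)
Lemma powR_le_affine (R : realType) (r y : R) :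
  0 <= r <= 1 -> 0 < y -> y `^ r <= 1 + r * (y - 1).
Proof.
move=> /andP[r0 r1] y0.
have : expR (r * ln y + (1 - r) * 0) <= r * expR (ln y) + (1 - r) * expR 0.
  exact: (convex_expR (Itv01 r0 r1) (ln y) 0).
by rewrite expR0 mulr0 addr0 mulr1 lnK ?posrE// /powR gt_eqF//; lra.
Qed.

(** Dividing by [(1 - t) `^ (a - 2)] leaves an upper bound on [(1 - t) `^ (2 - a)]
    by a quadratic polynomial in [t].  For [a <= 2] the exponent lies in [0, 1]
    and Bernoulli's inequality applies to it; for [2 <= a <= 4] the inequality is
    applied to the exponent [(a - 2) / 2] of [(1 - t)^-1], and then squared. *)
Lemma ratio_slope_ineq (R : realType) (a t : R) : 1 < a -> a <= 4 ->
  0 < t -> t <= 2^-1 ->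
  1 <= (1 - t) `^ a + a * t * (1 - t) `^ (a - 1)
       + 2 * a * (a - 1) * t ^+ 2 * (1 - t) `^ (a - 2).
Proof.
move=> a1 a4 t0 t12.
have s0 : 0 < 1 - t by lra.
have s_neq0 : 1 - t != 0 by lra.
have sD (r : R) (n : nat) : (1 - t) `^ (r + n%:R) = (1 - t) `^ r * (1 - t) ^+ n.
  by rewrite powRD ?s_neq0 ?implybT// powR_mulrn// ltW.
have -> : (1 - t) `^ a = (1 - t) `^ (a - 2) * (1 - t) ^+ 2.
  by rewrite -sD; congr (_ `^ _); ring.
have -> : (1 - t) `^ (a - 1) = (1 - t) `^ (a - 2) * (1 - t) ^+ 1.
  by rewrite -sD; congr (_ `^ _); ring.
(* The factor (1 - t) `^ (a - 2) is common to the right-hand side. *)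
suff : (1 - t) `^ (2 - a) <= (1 - t) ^+ 2 + a * t * (1 - t)
    + 2 * a * (a - 1) * t ^+ 2.
  move=> H; rewrite expr1.
  have P : 0 <= (1 - t) `^ (a - 2) by exact: powR_ge0.
  have E : (1 - t) `^ (a - 2) * (1 - t) `^ (2 - a) = 1.
    by rewrite -powRD ?s_neq0 ?implybT// addrC addrA subrK subrr powRr0.
  by have := ler_wpM2l P H; rewrite E; nra.
have [a2|a2] := leP a 2.
  apply: (le_trans (@powR_le_affine _ (2 - a) _ _ s0)); first by lra.
  (* This product is the excess of the quadratic over the affine bound. *)
  have : 0 <= (a - 1) * (2 * a - 1) * t ^+ 2.
    by rewrite !mulr_ge0 ?sqr_ge0//; lra.
  lra.
have -> : (1 - t) `^ (2 - a) = (((1 - t)^-1) `^ ((a - 2) / 2)) ^+ 2.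
  rewrite -powR_inv1 ?ltW// -powR_mulrn ?powR_ge0// -!powRrM.
  by congr (_ `^ _); field.
have y0 : 0 < (1 - t)^-1 by rewrite invr_gt0.
(* (1 - t)^-1 = 1 + t + t ^+ 2 / (1 - t), and 1 / (1 - t) <= 2. *)
have y_le : (1 - t)^-1 <= 1 + t + 2 * t ^+ 2.
  by rewrite -[_^-1]mul1r ler_pdivrMr//; nra.
have B : (1 - t)^-1 `^ ((a - 2) / 2) <= 1 + (a - 2) / 2 * (t + 2 * t ^+ 2).
  apply: (le_trans (@powR_le_affine _ ((a - 2) / 2) _ _ y0)); first by lra.
  by rewrite lerD2l; apply: ler_wpM2l; lra.
have P := powR_ge0 (1 - t)^-1 ((a - 2) / 2).
set p := _ `^ _ in B P *.
set g := (a - 2) / 2 in B.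
have -> : a = 2 * g + 2 by rewrite /g; field.
have g0 : 0 < g by rewrite /g; lra.
have g1 : g <= 1 by rewrite /g; lra.
clearbody g p.
(* z <= 2 t, because t <= 1/2. *)
set z := t + 2 * t ^+ 2 in B.
have z0 : 0 <= z by rewrite /z; nra.
have z2 : z ^+ 2 <= 4 * t ^+ 2.
  have -> : 4 * t ^+ 2 = (2 * t) ^+ 2 by ring.
  by rewrite ler_sqr ?nnegrE /z; nra.
have : p ^+ 2 <= (1 + g * z) ^+ 2 by rewrite ler_sqr ?nnegrE; nra.
move=> /le_trans; apply.
have q0 : g ^+ 2 * z ^+ 2 <= g ^+ 2 * (4 * t ^+ 2) by apply: ler_wpM2l; nra.
have -> : (1 + g * z) ^+ 2 = 1 + 2 * g * t + 4 * g * t ^+ 2 + g ^+ 2 * z ^+ 2.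
  by rewrite /z; ring.
have q1 : 0 <= g * t ^+ 2 by nra.
have q2 : 0 <= g ^+ 2 * t ^+ 2 by nra.
nra.
Qed.

(** * Concavity of the entropy ratio *)

(** This is [(a - 1) * h_alpha a q]; leaving out the division keeps the powers bare. *)
Definition scaled_entropy (R : realType) (a q : R) : R :=
  1 - q `^ a - (1 - q) `^ a.

Section Derivatives.
Variable R : realType.
Implicit Types a t x : R.

Lemma is_derive_powR_1B a t : t < 1 ->
  is_derive t 1 (fun u : R => (1 - u) `^ a) (- (a * (1 - t) `^ (a - 1))).
Proof.
move=> t1.
have ? : is_derive t 1 (cst 1 - id : R -> R) (-1).
  by apply: is_derive_eq; rewrite sub0r.
have ? : is_derive ((cst 1 - id : R -> R) t) 1 (@powR R ^~ a)
    (a * (1 - t) `^ (a - 1)).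
  by apply: is_derive1_powR; rewrite subr_gt0.
apply: (@is_derive_eq _ _ _ ((@powR R ^~ a) \o (cst 1 - id : R -> R))).
by rewrite mulrN1.
Qed.

Lemma is_derive_inv t : t != 0 -> is_derive t 1 (fun u : R => u^-1) (- t ^- 2).
Proof.
move=> t0.
have := @is_deriveV R id t 1 1 t0 (is_derive_id _ _).
by rewrite /GRing.scale /= mulr1.
Qed.

(** The mean value theorem on subintervals of ]0, b], where the derivatives of
    negative powers exist. *)
Lemma MVT_pos (f df : R -> R) (b : R) :
  (forall x, 0 < x <= b -> is_derive x 1 f (df x)) ->
  forall x y, 0 < x -> x <= y -> y <= b ->
  exists2 z, x <= z <= y & f y - f x = df z * (y - x).
Proof.
move=> fd x y x0 xy yb.
have I z : z \in `[x, y] -> 0 < z <= b.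
  by rewrite in_itv /= => /andP[? ?]; lra.
have [||z zI E] := @MVT_segment R f df x y xy.
- by move=> z /subset_itv_oo_cc /I; exact: fd.
- apply: derivable_within_continuous => z /I zI.
  exact: (@ex_derive _ _ _ _ _ _ _ (fd _ zI)).
by exists z => //; move: zI; rewrite in_itv.
Qed.

Lemma nincr_of_derive (f df : R -> R) (b : R) :
  (forall x, 0 < x <= b -> is_derive x 1 f (df x)) ->
  (forall x, 0 < x <= b -> df x <= 0) ->
  forall x y, 0 < x -> x <= y -> y <= b -> f y <= f x.
Proof.
move=> fd df0 x y x0 xy yb.
have [z /andP[xz zy] E] := MVT_pos fd x0 xy yb.
have zb : 0 < z <= b by lra.
have := df0 _ zb => dz.
by have : df z * (y - x) <= 0; [nra | lra].
Qed.

(** A function with nonincreasing derivative lies below its tangents: by the mean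
    value theorem the chord from [x] to [y] has the slope [df z] of a point [z]
    between them. *)
Lemma tangent_of_concave (f df : R -> R) (b : R) :
  (forall x, 0 < x <= b -> is_derive x 1 f (df x)) ->
  (forall x y, 0 < x -> x <= y -> y <= b -> df y <= df x) ->
  forall x y, 0 < x <= b -> 0 < y <= b -> f y <= f x + df x * (y - x).
Proof.
move=> fd dfd x y /andP[x0 xb] /andP[y0 yb].
have [xy|/ltW yx] := leP x y.
  have [z /andP[xz zy] E] := MVT_pos fd x0 xy yb.
  have := dfd x z x0 xz (le_trans zy yb) => H.
  by have : df z * (y - x) <= df x * (y - x); [apply: ler_wpM2r; lra | lra].
have [z /andP[yz zx] E] := MVT_pos fd y0 yx xb.
have := dfd z x (lt_le_trans y0 yz) zx xb => H.
by have : df x * (x - y) <= df z * (x - y); [apply: ler_wpM2r; lra | lra].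
Qed.

(** The derivative of [u |-> scaled_entropy a (u ^+ 2) / u], written as a function
    of [t = u ^+ 2]; see [is_derive_entropy_ratio]. *)
Definition ratio_slope a t : R :=
  2 * (a * (1 - t) `^ (a - 1) - a * t `^ (a - 1)) - scaled_entropy a t / t.

Lemma ratio_slope_nincr a t1 t2 : 1 < a -> a <= 4 ->
  0 < t1 -> t1 <= t2 -> t2 <= 2^-1 -> ratio_slope a t2 <= ratio_slope a t1.
Proof.
move=> a1 a4 t10 t12 t2h.
(* K collects the terms whose monotonicity needs the inequality above; the
   remaining one is a power of t with nonnegative exponent. *)
pose K t := 2 * a * (1 - t) `^ (a - 1) + ((1 - t) `^ a - 1) * t^-1.
have ratio_slopeE t : 0 < t -> ratio_slope a t = K t - (2 * a - 1) * t `^ (a - 1).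
  move=> t0; rewrite /ratio_slope /K /scaled_entropy.
  rewrite -(@mulr_powRB1 _ t a (ltW t0)); last by lra.
  by field; lra.
rewrite !ratio_slopeE ?(lt_le_trans t10)//; apply: lerB; last first.
  apply: ler_wpM2l; first by lra.
  by apply: ge0_ler_powR; rewrite ?nnegrE; lra.
pose dK t := - (2 * a * ((a - 1) * (1 - t) `^ (a - 1 - 1)))
   + (- (((1 - t) `^ a - 1) * t ^- 2) - t^-1 * (a * (1 - t) `^ (a - 1))).
apply: (@nincr_of_derive K dK 2^-1) => // t /andP[t0 th].
  have tlt1 : t < 1 by lra.
  have D1 := is_deriveZ (2 * a) (is_derive_powR_1B (a - 1) tlt1).
  have D2 := is_deriveB (is_derive_powR_1B a tlt1) (is_derive_cst (1 : R) t 1).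
  have D3 := is_deriveD D1 (is_deriveM D2 (is_derive_inv (lt0r_neq0 t0))).
  apply: (is_derive_eq D3).
  by rewrite /dK /GRing.scale /= !fctE /=; ring.
have := ratio_slope_ineq a1 a4 t0 th => key.
have -> : dK t = (1 - ((1 - t) `^ a + a * t * (1 - t) `^ (a - 1)
       + 2 * a * (a - 1) * t ^+ 2 * (1 - t) `^ (a - 2))) / t ^+ 2.
  rewrite /dK; have -> : a - 1 - 1 = a - 2 by ring.
  by field; lra.
by rewrite pmulr_lle0 ?invr_gt0 ?exprn_gt0// subr_le0.
Qed.

Lemma is_derive_entropy_ratio a x : 0 < x -> x < 1 ->
  is_derive x 1 (fun u => scaled_entropy a (u ^+ 2) / u) (ratio_slope a (x ^+ 2)).
Proof.
move=> x0 x1.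
have xx0 : 0 < x ^+ 2 by rewrite exprn_gt0.
have xx1 : x ^+ 2 < 1 by nra.
have E : is_derive (x ^+ 2) 1 (scaled_entropy a)
    (a * (1 - x ^+ 2) `^ (a - 1) - a * (x ^+ 2) `^ (a - 1)).
  have ? := is_derive_powR_1B a xx1.
  have ? := is_derive1_powR a xx0.
  apply: (@is_derive_eq _ _ _ (cst 1 - (@powR R ^~ a) - (fun u => (1 - u) `^ a))).
  by rewrite sub0r opprK addrC.
have S : is_derive x 1 (fun u : R => u ^+ 2) (2 * x).
  apply: (@is_derive_eq _ _ _ ((@id R) ^+ 2)).
  by rewrite /GRing.scale /= mulr1 expr1 mulr_natl.
have ? : is_derive x 1 (scaled_entropy a \o (fun u : R => u ^+ 2))
   ((a * (1 - x ^+ 2) `^ (a - 1) - a * (x ^+ 2) `^ (a - 1)) * (2 * x)).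
  exact: (@is_derive1_comp _ (scaled_entropy a) (fun u => u ^+ 2) x _ _ E S).
have ? : is_derive x 1 (fun u : R => u^-1) (- x ^- 2).
  by apply: is_derive_inv; rewrite gt_eqF.
apply: (@is_derive_eq _ _ _ ((scaled_entropy a \o (fun u : R => u ^+ 2))
   * (fun u => u^-1))).
rewrite /GRing.scale /= /ratio_slope; field; lra.
Qed.

(** Concavity of [u |-> scaled_entropy a (u ^+ 2) / u] on ]0, 1 / sqrt 2], in the
    form in which Jensen's inequality uses it. *)
Lemma entropy_ratio_tangent a x y : 1 < a -> a <= 4 ->
  0 < x -> x ^+ 2 <= 2^-1 -> 0 < y -> y ^+ 2 <= 2^-1 ->
  scaled_entropy a (y ^+ 2) / y <=
  scaled_entropy a (x ^+ 2) / x + ratio_slope a (x ^+ 2) * (y - x).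
Proof.
move=> a1 a4 x0 xh y0 yh.
pose b := Num.max x y.
have bh : b ^+ 2 <= 2^-1 by rewrite /b; case: (ltP x y).
have b1 : b < 1 by rewrite ltNge; apply/negP => b_ge1; nra.
apply: (@tangent_of_concave (fun u => scaled_entropy a (u ^+ 2) / u)
  (fun u => ratio_slope a (u ^+ 2)) b).
- move=> z /andP[z0 zb]; apply: is_derive_entropy_ratio => //; lra.
- move=> u v u0 uv vb; apply: ratio_slope_nincr => //; nra.
- by rewrite x0 /b le_max lexx.
- by rewrite y0 /b le_max lexx orbT.
Qed.

End Derivatives.

(** Jensen's inequality for the weights [p i / k] at the points [p i].  The tangent
    inequality is multiplied by [p i], which makes it hold also at [p i = 0]; after
    summation the tangent's linear term vanishes because [l] is the weighted
    mean. *)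
Lemma entropy_ratio_jensen (R : realType) (a : R) (I : finType) (p : I -> R)
    (k : R) : 1 < a -> a <= 4 -> 0 < k -> \sum_i p i = k ->
  (forall i, 0 <= p i) -> (forall i, p i ^+ 2 <= 2^-1) ->
  let l := \sum_i p i / k * p i in
  [/\ 0 < l, l ^+ 2 <= 2^-1 &
    \sum_i scaled_entropy a (p i ^+ 2) <= k * (scaled_entropy a (l ^+ 2) / l)].
Proof.
move=> a1 a4 k0 pk p0 ph l.
have lk : \sum_i p i * p i = l * k.
  by rewrite mulr_suml; apply: eq_bigr => i _; field; lra.
have l0 : 0 < l.
  have [i pi0] : exists i, 0 < p i.
    apply/existsP; apply: contraLR k0 => /existsPn p_le0.
    by rewrite -pk -leNgt; apply: sumr_le0 => i _; rewrite leNgt.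
  rewrite -(pmulr_lgt0 _ k0) -lk (bigD1 i)//= ltr_pwDl ?mulr_gt0//.
  by apply: sumr_ge0 => j _; rewrite mulr_ge0.
have lh : l ^+ 2 <= 2^-1.
  (* l is an average of the p i, so it obeys their common upper bound. *)
  have ps i : p i <= Num.sqrt 2^-1 by rewrite -ler_sqr ?nnegrE ?sqr_sqrtr// sqrtr_ge0.
  have ls : l <= Num.sqrt 2^-1.
    rewrite -(ler_pM2r k0) -lk -pk mulr_sumr; apply: ler_sum => i _.
    by rewrite ler_wpM2r.
  by rewrite -[leRHS]sqr_sqrtr// ler_sqr// nnegrE ?sqrtr_ge0// ltW.
split=> //.
have term i : scaled_entropy a (p i ^+ 2) <=
    p i * (scaled_entropy a (l ^+ 2) / l) +
    ratio_slope a (l ^+ 2) * (p i * p i - l * p i).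
  have [->|pi_neq0] := eqVneq (p i) 0.
    rewrite expr0n /= !mul0r mulr0 subr0 mulr0 add0r.
    by rewrite /scaled_entropy powR0 ?subr0 ?powR1 ?subrr//; lra.
  have pi0 : 0 < p i by rewrite lt_neqAle eq_sym pi_neq0 p0.
  have := entropy_ratio_tangent a1 a4 l0 lh pi0 (ph i).
  rewrite ler_pdivrMr// => /le_trans; apply; rewrite le_eqVlt.
  by apply/orP; left; apply/eqP; ring.
apply: (le_trans (ler_sum _ (fun i _ => term i))).
rewrite big_split /= -mulr_suml -mulr_sumr big_split /= sumrN -mulr_sumr lk pk.
by rewrite subrr mulr0 addr0.
Qed.

(** * Subadditivity of the Tsallis entropy *)

Section Entropy.
Variables (R : realType) (a : R).
Hypothesis a1 : 1 < a.
Implicit Types q w x y : R.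

Let a_neq0 : a != 0.
Proof. by rewrite gt_eqF// (lt_trans ltr01). Qed.

Lemma powR_convex w x y : 0 <= w <= 1 -> 0 <= x -> 0 <= y ->
  (w * x + (1 - w) * y) `^ a <= w * x `^ a + (1 - w) * y `^ a.
Proof.
move=> /andP[w0 w1] x0 y0.
by apply: (convex_powR (ltW a1) (Itv01 w0 w1));
  rewrite inE /= in_itv /= andbT.
Qed.

Lemma scaled_entropy_concave w x y :
  0 <= w <= 1 -> 0 <= x <= 1 -> 0 <= y <= 1 ->
  w * scaled_entropy a x + (1 - w) * scaled_entropy a y <=
  scaled_entropy a (w * x + (1 - w) * y).
Proof.
move=> w01 /andP[x0 x1] /andP[y0 y1]; rewrite /scaled_entropy.
have P := powR_convex w01 x0 y0.
have Q : (1 - (w * x + (1 - w) * y)) `^ a <=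
    w * (1 - x) `^ a + (1 - w) * (1 - y) `^ a.
  have -> : 1 - (w * x + (1 - w) * y) = w * (1 - x) + (1 - w) * (1 - y) by ring.
  by apply: powR_convex; rewrite ?subr_ge0.
lra.
Qed.

Lemma scaled_entropy_ge0 q : 0 <= q <= 1 -> 0 <= scaled_entropy a q.
Proof.
move=> q01.
have := @scaled_entropy_concave q 1 0 q01.
rewrite /scaled_entropy !subr0 subrr powR1 powR0// mulr1 mulr0 addr0.
by rewrite !subr0 !subrr !mulr0 addr0; apply; rewrite lexx ler01.
Qed.

(** A concave function that is symmetric about 1/2 increases up to 1/2, because [y]
    lies between [x] and its mirror image [1 - x]. *)
Lemma scaled_entropy_ndecr x y :
  0 <= x -> x <= y -> y <= 2^-1 -> scaled_entropy a x <= scaled_entropy a y.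
Proof.
move=> x0 xy yh; have [->//|x_neq] := eqVneq x y.
have xlt : x < y by rewrite lt_neqAle x_neq.
have d0 : 0 < 1 - 2 * x by lra.
(* The weight for which w * x + (1 - w) * (1 - x) = y. *)
pose w := (1 - x - y) / (1 - 2 * x).
have w01 : 0 <= w <= 1.
  by apply/andP; split; [apply: divr_ge0 | rewrite ler_pdivrMr]; lra.
have := @scaled_entropy_concave w x (1 - x) w01.
have -> : scaled_entropy a (1 - x) = scaled_entropy a x.
  by rewrite /scaled_entropy subKr; ring.
have -> : w * x + (1 - w) * (1 - x) = y by rewrite /w; field; lra.
by rewrite -mulrDl subrKC mul1r; apply; lra.
Qed.

(** The homogeneous form of [scaled_entropy] (see [entropy_gapE]): with counts [c]
    and [N] instead of the proportion [c / N], an induction that splits a family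
    needs no renormalization and no case of an empty part. *)
Definition entropy_gap (N c : R) : R := N `^ a - c `^ a - (N - c) `^ a.

Lemma entropy_gapE N c : 0 < N -> 0 <= c <= N ->
  entropy_gap N c = N `^ a * scaled_entropy a (c / N).
Proof.
move=> N0 /andP[c0 cN].
have r0 : 0 <= c / N by rewrite divr_ge0// ltW.
have r1 : 0 <= 1 - c / N by rewrite subr_ge0 ler_pdivrMr ?mul1r.
have N_ge0 := ltW N0.
rewrite /entropy_gap /scaled_entropy !mulrBr mulr1 -!powRM//.
have -> : N * (c / N) = c by field; lra.
by have -> : N * (1 - c / N) = N - c by field; lra.
Qed.

(** With [w = N1 / (N1 + N2)], the conditional entropies on the left enter with the
    weights [w `^ a] and [(1 - w) `^ a].  These are at most [w] and [1 - w], so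
    the claim follows from concavity of the entropy and its nonnegativity. *)
Lemma entropy_gap_superadditive N1 N2 c1 c2 :
  0 <= c1 <= N1 -> 0 <= c2 <= N2 ->
  entropy_gap N1 c1 + entropy_gap N2 c2 <= entropy_gap (N1 + N2) (c1 + c2).
Proof.
move=> /andP[c10 c1N] /andP[c20 c2N].
have gap00 : entropy_gap 0 0 = 0 by rewrite /entropy_gap subr0 powR0// !subr0.
have [N10|N10] := eqVneq N1 0.
  have -> : c1 = 0 by lra.
  by rewrite N10 gap00 !add0r.
have [N20|N20] := eqVneq N2 0.
  have -> : c2 = 0 by lra.
  by rewrite N20 gap00 !addr0.
have {}N10 : 0 < N1 by rewrite lt_neqAle eq_sym N10; lra.
have {}N20 : 0 < N2 by rewrite lt_neqAle eq_sym N20; lra.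
have N0 : 0 < N1 + N2 by rewrite addr_gt0.
have r01 (N c : R) : 0 < N -> 0 <= c -> c <= N -> 0 <= c / N <= 1.
  by move=> Npos cge0 cle; rewrite ler_pdivrMr// mul1r cle divr_ge0// ltW.
rewrite !entropy_gapE//; try by apply/andP; split; lra.
pose w := N1 / (N1 + N2).
have w01 : 0 <= w <= 1 by apply: r01; lra.
have w'E : 1 - w = N2 / (N1 + N2) by rewrite /w; field; lra.
have w'01 : 0 <= 1 - w <= 1 by lra.
have := scaled_entropy_concave w01 (r01 _ _ N10 c10 c1N) (r01 _ _ N20 c20 c2N).
have -> : w * (c1 / N1) + (1 - w) * (c2 / N2) = (c1 + c2) / (N1 + N2).
  by rewrite w'E /w; field; lra.
have S1 := scaled_entropy_ge0 (r01 _ _ N10 c10 c1N).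
have S2 := scaled_entropy_ge0 (r01 _ _ N20 c20 c2N).
have N_ge0 := powR_ge0 (N1 + N2) a.
(* Convexity of the power along the segment from 0 to 1. *)
have pow_le v : 0 <= v <= 1 -> v `^ a <= v.
  move=> v01; have := @powR_convex v 1 0 v01 ler01 (lexx _).
  by rewrite powR1 powR0// !mulr1 !mulr0 !addr0.
move=> /(ler_wpM2l N_ge0); apply: le_trans; rewrite [leRHS]mulrDr.
have w0 : 0 <= w by lra.
have w'0 : 0 <= 1 - w by lra.
have N1E : (N1 + N2) * w = N1 by rewrite /w; field; lra.
have N2E : (N1 + N2) * (1 - w) = N2 by rewrite w'E; field; lra.
have -> : N1 `^ a = (N1 + N2) `^ a * w `^ a.
  by rewrite -powRM ?N1E// ltW.
have -> : N2 `^ a = (N1 + N2) `^ a * (1 - w) `^ a.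
  by rewrite -powRM ?N2E// ltW.
by apply: lerD; rewrite -mulrA; apply: ler_wpM2l => //;
  apply: ler_wpM2r => //; exact: pow_le.
Qed.

(** Subadditivity of the Tsallis entropy for the uniform distribution on [F], in
    homogeneous form: the left-hand side is [#|F| `^ a * (a - 1)] times the entropy
    of a random member of [F], and each summand is the same multiple of the
    entropy of one coordinate.  The list [s] only has to separate the members of
    [F], which is what survives when [F] is split by whether its members contain
    the head of [s]. *)
Lemma entropy_subadditive (T : finType) (s : seq T) (F : {set {set T}}) :
  (forall A B, A \in F -> B \in F ->
    {in s, forall z, (z \in A) = (z \in B)} -> A = B) ->
  #|F|%:R `^ a - #|F|%:R <=
  \sum_(x <- s) entropy_gap #|F|%:R #|[set A in F | x \in A]|%:R.
Proof.
elim: s F => [|x s IHs] F sepF.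
  rewrite big_nil.
  have : (#|F| <= 1)%N by apply/card_le1_eqP => A B FA FB; apply: sepF.
  case: #|F| => [|[|//]] _; last by rewrite powR1 subrr.
  by rewrite mulr0n powR0// subrr.
pose F1 := [set A in F | x \in A]; pose F0 := [set A in F | x \notin A].
have split_card (P : pred {set T}) :
    #|[set A in F | P A]| = (#|[set A in F1 | P A]| + #|[set A in F0 | P A]|)%N.
  rewrite -[LHS](cardsID [set A : {set T} | x \in A]); congr addn.
    by apply: eq_card => A; rewrite !inE -!andbA; congr andb; rewrite andbC.
  by apply: eq_card => A; rewrite !inE andbCA andbA.
have FE : #|F| = (#|F1| + #|F0|)%N.
  rewrite -(cardsID [set A : {set T} | x \in A] F); congr addn.
    by apply: eq_card => A; rewrite !inE.
  by apply: eq_card => A; rewrite !inE andbC.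
rewrite big_cons -/F1.
have deg_le (G : {set {set T}}) (z : T) : (#|[set A in G | z \in A]| <= #|G|)%N.
  by apply: subset_leq_card; apply/fintype.subsetP => A; rewrite inE => /andP[].
have {}IHs (G : {set {set T}}) :
    {subset G <= F} -> {in G &, forall A B : {set T}, (x \in A) = (x \in B)} ->
    #|G|%:R `^ a - #|G|%:R <=
    \sum_(z <- s) entropy_gap #|G|%:R #|[set A in G | z \in A]|%:R.
  move=> subG constG; apply: IHs => A B GA GB AB.
  apply: sepF; rewrite ?subG// => z; rewrite inE => /predU1P[->|]; last exact: AB.
  exact: constG.
have H1 : #|F1|%:R `^ a - #|F1|%:R <=
    \sum_(z <- s) entropy_gap #|F1|%:R #|[set A in F1 | z \in A]|%:R.
  apply: IHs => [A|A B]; rewrite !inE; first by case/andP.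
  by move=> /andP[_ ->] /andP[_ ->].
have H0 : #|F0|%:R `^ a - #|F0|%:R <=
    \sum_(z <- s) entropy_gap #|F0|%:R #|[set A in F0 | z \in A]|%:R.
  apply: IHs => [A|A B]; rewrite !inE; first by case/andP.
  by move=> /andP[_ /negbTE->] /andP[_ /negbTE->].
(* The chain rule: first reveal whether x belongs to the random member. *)
have -> : #|F|%:R `^ a - #|F|%:R = entropy_gap #|F|%:R #|F1|%:R +
    ((#|F1|%:R `^ a - #|F1|%:R) + (#|F0|%:R `^ a - #|F0|%:R)).
  rewrite /entropy_gap; have -> : #|F|%:R - #|F1|%:R = #|F0|%:R :> R.
    by rewrite FE natrD addrAC subrr add0r.
  by rewrite {2}FE natrD; ring.
rewrite lerD2l; apply: le_trans (lerD H1 H0) _.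
rewrite -big_split /=; apply: ler_sum => z _.
rewrite (split_card (fun A : {set T} => z \in A)) FE !natrD.
by apply: entropy_gap_superadditive; rewrite !ler0n !ler_nat deg_le.
Qed.

End Entropy.

(** * Tsallis logarithm and entropy against their Shannon limits *)

Section TsallisEntropy.
Variables (R : realType) (a : R).
Hypothesis a1 : 1 < a.

Let a_neq0 : a != 0.
Proof. by rewrite gt_eqF// (lt_trans ltr01). Qed.

Lemma entropy_term_gt1 (q : R) : 0 <= q ->
  entropy_term a q = (q - q `^ a) / (a - 1).
Proof.
move=> q0; rewrite /entropy_term /ln_alpha (gt_eqF a1).
have [->|q_neq0] := eqVneq q 0; first by rewrite /= powR0 ?subrr ?mul0r.
have E : q `^ a * q `^ (1 - a) = q.
  by rewrite -powRD ?q_neq0 ?implybT// subrKC powRr1.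
have a1_gt0 : 0 < a - 1 by rewrite subr_gt0.
rewrite -[X in X - q `^ a]E; field; lra.
Qed.

Lemma h_alpha_gt1 (q : R) : 0 <= q <= 1 ->
  h_alpha a q = scaled_entropy a q / (a - 1).
Proof.
move=> /andP[q0 q1]; rewrite /h_alpha !entropy_term_gt1 ?subr_ge0//.
by rewrite -mulrDl /scaled_entropy; congr (_ / _); ring.
Qed.

(** Termwise, [r `^ (a - 1) >= 1 + (a - 1) * ln r]. *)
Lemma h_alpha_le_shannon (q : R) : 0 <= q <= 1 -> h_alpha a q <= h_alpha 1 q.
Proof.
have term (r : R) : 0 <= r -> entropy_term a r <= entropy_term 1 r.
  move=> r0; rewrite (entropy_term_gt1 r0) /entropy_term /ln_alpha eqxx powRr1//.
  have [->|r_neq0] := eqVneq r 0; first by rewrite /= powR0 ?subrr ?mul0r.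
  have rgt0 : 0 < r by rewrite lt_neqAle eq_sym r_neq0.
  rewrite ler_pdivrMr ?subr_gt0//.
  rewrite -(mulr_powRB1 r0 (lt_trans ltr01 a1)).
  have : 1 + (a - 1) * ln r <= r `^ (a - 1).
    by rewrite [r `^ _]/powR gt_eqF// expR_ge1Dx.
  by move=> /(ler_wpM2l r0); lra.
by move=> /andP[q0 q1]; apply: lerD; apply: term; rewrite ?subr_ge0.
Qed.

(** With [y = (a - 1) * ln x], this is [y <= (1 - expR (- y)) * (1 + y)], a form of
    [1 + y <= expR y].  The factor on the right tends to 1 as [a] tends to 1. *)
Lemma ln_le_ln_alpha (x : R) : 1 <= x ->
  ln x <= ln_alpha a x * (1 + (a - 1) * ln x).
Proof.
move=> x1; have x0 : 0 < x by lra.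
have L0 : 0 <= ln x by rewrite ln_ge0.
have a1_gt0 : 0 < a - 1 by rewrite subr_gt0.
rewrite /ln_alpha (gt_eqF a1) /powR (gt_eqF x0).
have -> : (1 - a) * ln x = - ((a - 1) * ln x) by ring.
set y := (a - 1) * ln x; have y0 : 0 <= y by rewrite mulr_ge0// subr_ge0 ltW.
have E : expR (- y) * (1 + y) <= 1.
  rewrite expRN mulrC ler_pdivrMr ?expR_gt0// mul1r; exact: expR_ge1Dx.
have -> : (expR (- y) - 1) / (1 - a) * (1 + y)
    = (1 + y - expR (- y) * (1 + y)) / (a - 1) by field; lra.
by rewrite ler_pdivlMr ?subr_gt0//; rewrite /y in E *; lra.
Qed.

End TsallisEntropy.

Lemma entropy_subadditive_ratio (R : realType) (a : R) (n : nat)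
    (F : {set {set 'I_n}}) : 1 < a -> (0 < #|F|)%N ->
  ln_alpha a #|F|%:R <= (\sum_j scaled_entropy a
    (#|[set A in F | j \in A]|%:R / #|F|%:R)) / (a - 1).
Proof.
move=> a1 F0.
have N0 : 0 < #|F|%:R :> R by rewrite ltr0n.
have a1_gt0 : 0 < a - 1 by rewrite subr_gt0.
have sub : #|F|%:R `^ a - #|F|%:R <= \sum_(j <- enum 'I_n)
    entropy_gap a #|F|%:R #|[set A in F | j \in A]|%:R.
  apply: entropy_subadditive => // A B _ _ AB; apply/setP => j.
  by apply: AB; rewrite mem_enum.
rewrite /ln_alpha (gt_eqF a1) ler_pdivlMr// -(ler_pM2l (powR_gt0 a N0)).
have -> : (#|F|%:R `^ (1 - a) - 1) / (1 - a) * (a - 1) = 1 - #|F|%:R `^ (1 - a).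
  by field; lra.
have NN : #|F|%:R `^ a * #|F|%:R `^ (1 - a) = #|F|%:R :> R.
  by rewrite -powRD ?(gt_eqF N0) ?implybT// subrKC powRr1 ?ltW.
rewrite mulrBr mulr1 NN.
apply: (le_trans sub); rewrite big_enum /= mulr_sumr; apply: ler_sum => j _.
rewrite entropy_gapE// ler0n ler_nat subset_leq_card//.
by apply/fintype.subsetP => A; rewrite inE => /andP[].
Qed.

(** * Intersections of pairs *)

Section PairwiseIntersections.
Variables (n m : nat) (G : 'I_m -> {set 'I_n}).
Hypothesis G_inter : distinct_intersections G.

Definition pair_set : {set {set 'I_m}} := [set A : {set 'I_m} | #|A| == 2%N]%SET.
Definition common_part (A : {set 'I_m}) : {set 'I_n} := (\bigcap_(i in A) G i)%SET.

Lemma common_part_inj : {in pair_set &, injective common_part}.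
Proof.
have common_part2 i j : i != j -> common_part [set i; j]%SET = (G i :&: G j)%SET.
  by move=> ij; rewrite /common_part big_setU1 ?inE//= big_set1.
move=> A B; rewrite !inE => /cards2P[i [j [ij ->]]] /cards2P[s [t [st ->]]].
rewrite !common_part2// => E; apply/eqP; apply: contraT => ijst.
by have /eqP := G_inter ij st ijst.
Qed.

Lemma card_common_parts : #|[set common_part A | A in pair_set]%SET| = 'C(m, 2).
Proof. by rewrite card_in_imset ?card_draws ?card_ord//; exact: common_part_inj. Qed.

(** A pair has [x] in its common part exactly when both of its indices belong to
    the set of the members that contain [x]. *)
Lemma card_common_parts_containing (x : 'I_n) :
  #|[set B in [set common_part A | A in pair_set]%SET | x \in B]%SET| =
  'C(#|[set i | x \in G i]%SET|, 2).
Proof.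
rewrite -cards_draws -[RHS](@card_in_imset _ _ common_part); last first.
  by move=> A B; rewrite !inE => /andP[_ A2] /andP[_ B2]; apply: common_part_inj; rewrite inE.
apply: eq_card => B; rewrite inE; apply/andP/imsetP.
  move=> [/imsetP[A A2 ->] /bigcapP xA]; exists A => //.
  rewrite !inE in A2 *; rewrite A2 andbT.
  by apply/fintype.subsetP => i /xA; rewrite inE.
move=> [A]; rewrite inE => /andP[/fintype.subsetP AS A2] ->; split.
  by apply: imset_f; rewrite inE.
by apply/bigcapP => i /AS; rewrite inE.
Qed.

End PairwiseIntersections.

(** Two draws without replacement fall into a set no more often than two
    independent draws. *)
Lemma bin2_ratio_le (R : realType) (d m : nat) : (d <= m)%N -> (1 < m)%N ->
  'C(d, 2)%:R / 'C(m, 2)%:R <= (d%:R / m%:R) ^+ 2 :> R.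
Proof.
move=> dm m1.
have bin2R e : 'C(e, 2)%:R = e%:R * (e%:R - 1) / 2 :> R.
  case: e => [|e]; first by rewrite mul0r mul0r.
  have : (2 * 'C(e.+1, 2))%N%:R = (e.+1 * e)%N%:R :> R.
    by rewrite -mul_bin_diag bin1.
  rewrite !natrM -[in RHS](addn1 e) natrD -[e.+1%:R]natr1 addrK => E.
  by rewrite -[LHS](mulKf (_ : 2 != 0 :> R))// E; field.
have mR : 1 < m%:R :> R by rewrite ltr1n.
have dR : d%:R <= m%:R :> R by rewrite ler_nat.
have d0 : 0 <= d%:R :> R by rewrite ler0n.
rewrite !bin2R; move: (d%:R) (m%:R) mR dR d0 => x y y1 xy x0.
have -> : x * (x - 1) / 2 / (y * (y - 1) / 2) = x * (x - 1) * y / (y ^+ 2 * (y - 1)).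
  by field; lra.
have -> : (x / y) ^+ 2 = x ^+ 2 * (y - 1) / (y ^+ 2 * (y - 1)) by field; lra.
apply: ler_wpM2r; first by rewrite invr_ge0 mulr_ge0 ?sqr_ge0//; lra.
nra.
Qed.

(** * The bound for the family *)

Section IntersectingFamily.
Variables (R : realType) (n m k : nat) (G : 'I_m -> {set 'I_n}).
Hypothesis k_ge1 : (1 <= k)%N.
Hypothesis m_gt0 : (0 < m)%N.
Hypothesis G_card : forall i : 'I_m, #|G i| = k.
Hypothesis G_inter : distinct_intersections G.
Hypothesis G_prop : forall j : 'I_n,
  containing_proportion R G j <= 1 / Num.sqrt 2.

Let p (j : 'I_n) : R := containing_proportion R G j.
Let lambda : R := \sum_(j < n) p j / k%:R * p j.

Lemma proportion_ge0 j : 0 <= p j.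
Proof. by rewrite divr_ge0 ?ler0n. Qed.

Lemma sum_proportion : \sum_j p j = k%:R.
Proof.
have mR : m%:R != 0 :> R by rewrite pnatr_eq0 -lt0n.
rewrite -mulr_suml -natr_sum -[RHS](mulfK mR) -natrM; congr (_%:R / _).
(* Count the incidences j \in G i in two ways. *)
transitivity (\sum_(i < m) \sum_(j < n) (j \in G i))%N.
  rewrite exchange_big /=; apply: eq_bigr => j _.
  by rewrite -sum1_card big_mkcond /=; apply: eq_bigr => i _; rewrite inE; case: in_mem.
have -> : (k * m = \sum_(i < m) k)%N by rewrite sum_nat_const card_ord mulnC.
apply: eq_bigr => i _; rewrite -(G_card i) -sum1_card [RHS]big_mkcond.
by apply: eq_bigr => j _; case: in_mem.
Qed.

Lemma proportion_sqr_le j : p j ^+ 2 <= 2^-1.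
Proof.
have -> : 2^-1 = (1 / Num.sqrt 2) ^+ 2 :> R by rewrite expr_div_n sqr_sqrtr// expr1n mul1r.
by rewrite ler_sqr ?nnegrE ?proportion_ge0// divr_ge0.
Qed.

(** The only member of a one-member family would contain a point of proportion 1. *)
Lemma family_gt1 : (1 < m)%N.
Proof.
rewrite ltn_neqAle m_gt0 andbT; apply/eqP => m1.
pose i0 : 'I_m := Ordinal m_gt0.
have [j jG] : exists j, j \in G i0 by apply/set0Pn; rewrite -card_gt0 G_card.
have := proportion_sqr_le j; rewrite /p /containing_proportion.
have -> : [set i | j \in G i]%SET = [set: 'I_m]%SET.
  apply/setP => i; rewrite !inE -jG; congr (_ \in G _); apply: val_inj => /=.
  by apply/eqP; rewrite -leqn0 -ltnS m1.
by rewrite cardsT card_ord -m1 divr1 expr1n; lra.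
Qed.

(** Subadditivity and Jensen's inequality combined.  The bounds on [lambda] are
    recorded as well, since the passage to the limit [a = 1] compares entropies at
    [lambda ^+ 2]. *)
Lemma ln_alpha_pairs_le (a : R) : 1 < a -> a <= 4 ->
  [/\ 0 < lambda, lambda ^+ 2 <= 2^-1 &
  ln_alpha a ('C(m, 2))%:R <= k%:R * (h_alpha a (lambda ^+ 2) / lambda)].
Proof.
move=> a1 a4.
have k0 : 0 < k%:R :> R by rewrite ltr0n.
have a1_gt0 : 0 < a - 1 by rewrite subr_gt0.
have [l0 lh J] := entropy_ratio_jensen a1 a4 k0 sum_proportion proportion_ge0
  proportion_sqr_le.
rewrite -/lambda in l0 lh J; split=> //.
have C0 : (0 < 'C(m, 2))%N by rewrite bin_gt0 family_gt1.
have := @entropy_subadditive_ratio R a n [set common_part G A | A in pair_set m]%SET a1.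
rewrite card_common_parts// => /(_ C0) /le_trans; apply.
rewrite (h_alpha_gt1 a1); last by rewrite sqr_ge0; lra.
rewrite [_ / _ / lambda]mulrAC mulrA ler_pM2r ?invr_gt0//; apply: le_trans J.
apply: ler_sum => j _; rewrite card_common_parts_containing//.
apply: scaled_entropy_ndecr => //.
- by apply: bin2_ratio_le family_gt1; rewrite -[leqRHS]card_ord max_card.
- exact: proportion_sqr_le.
Qed.

End IntersectingFamily.

Theorem proposition6 (R : realType) (n m k : nat) (G : 'I_m -> {set 'I_n})
    (k_ge1 : (1 <= k)%N) (m_gt0 : (0 < m)%N)
    (G_card : forall i : 'I_m, #|G i| = k)
    (G_inter : distinct_intersections G)
    (G_prop : forall j : 'I_n,
       containing_proportion R G j <= 1 / Num.sqrt 2)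
    (alpha : R) (alpha_ge1 : 1 <= alpha) (alpha_le : alpha <= 367 / 100) :
  let lambda : R := \sum_(j < n)
    containing_proportion R G j / k%:R * containing_proportion R G j in
  ln_alpha alpha ('C(m, 2))%:R <= k%:R * (h_alpha alpha (lambda ^+ 2) / lambda).
Proof.
cbv zeta; set lambda := \sum_(j < n) _.
have bound (a : R) (a1 : 1 < a) (a4 : a <= 4) :=
  ln_alpha_pairs_le k_ge1 m_gt0 G_card G_inter G_prop a1 a4.
rewrite -/lambda in bound.
have [a1|a_le1] := ltP 1 alpha.
  have [|_ _] := bound alpha a1; [lra | exact].
have -> : alpha = 1 by lra.
pose L : R := ln ('C(m, 2))%:R.
set B := k%:R * _.
have C1 : 1 <= ('C(m, 2))%:R :> R.
  by rewrite ler1n bin_gt0 (family_gt1 k_ge1 m_gt0 G_card G_prop).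
have L0 : 0 <= L by exact: ln_ge0.
(* The bound at alpha = 1 + e, compared with both sides at alpha = 1. *)
have near1 e : 0 < e -> e <= 1 -> L <= B * (1 + e * L).
  move=> e0 e1.
  have a1 : 1 < 1 + e by rewrite ltrDl.
  have [||l0 lh le] := bound (1 + e); [exact: a1 | lra |].
  apply: (le_trans (ln_le_ln_alpha a1 C1)).
  rewrite [1 + e - 1]addrAC subrr add0r -/L.
  apply: ler_wpM2r; first by rewrite addr_ge0// mulr_ge0// ltW.
  apply: (le_trans le); rewrite ler_wpM2l ?ler0n// ler_wpM2r ?invr_ge0 ?(ltW l0)//.
  by apply: h_alpha_le_shannon => //; rewrite sqr_ge0; lra.
rewrite /ln_alpha eqxx -/L.
have B0 : 0 <= B.
  have := near1 1 ltr01 (lexx _); rewrite mul1r => LB.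
  by rewrite -(pmulr_lge0 _ (_ : 0 < 1 + L)) ?(le_trans L0 LB)//; lra.
have BL0 : 0 <= B * L by rewrite mulr_ge0.
apply/ler_addgt0Pr => e e0.
have d0 : 0 < B * L + 1 + e by lra.
(* A step at most 1 for which the error B * step * L is at most e. *)
have := near1 (e / (B * L + 1 + e)).
rewrite divr_gt0// ler_pdivrMr// mul1r => /(_ isT) H.
apply: (le_trans (H _)); first lra.
have -> : B * (1 + e / (B * L + 1 + e) * L) = B + e * (B * L) / (B * L + 1 + e).
  by field; lra.
rewrite lerD2l ler_pdivrMr//; nra.
Qed.
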